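(* Let $A$ be an arbitrary index set and let $X=\prod_{\alpha\in A}X_\alpha$ be the Tychonoff product of topological spaces $X_\alpha$. Assume that $G_\alpha$ is a homeomorphism group of $X_\alpha$ for each $\alpha\in A$. Then the direct product of groups $G=\prod_{\alpha\in A}G_\alpha$ has a dense union of closed orbits in $X$ if and only if for every $\alpha\in A$ the group $G_\alpha$ has a dense union of closed orbits in $X_\alpha$.
   Context: A homeomorphism group of $X$ is a group of homeomorphisms of $X$ onto itself (no topology on the group is assumed). Every space on which a group acts is assumed to be infinite. The group $G=\prod_\alpha G_\alpha$ (with componentwise multiplication) acts on $X=\prod_\alpha X_\alpha$ canonically, i.e. $\{g_\alpha\}.\{x_\alpha\}=\{g_\alpha.x_\alpha\}$; the Tychonoff product carries the product topology. The orbit of $x$ is $G.x=\{g.x : g\in G\}$; a closed orbit is an orbit that is a closed subset of the space. ''Has a dense union of closed orbits'' means that the union of all closed orbits is dense in the space. *)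

(* Defs.v *)
From HB Require Import structures.
From mathcomp Require Import all_boot all_classical topology function_spaces.

Set Implicit Arguments.
Unset Strict Implicit.
Unset Printing Implicit Defensive.

Local Open Scope classical_set_scope.
Local Open Scope group_scope.

Record homeo (X : topologicalType) := Homeo {
  homeo_fun :> X -> X;
  homeo_inv : X -> X;
  homeo_funK : cancel homeo_fun homeo_inv;
  homeo_invK : cancel homeo_inv homeo_fun;
  homeo_continuous : continuous homeo_fun;
  homeo_inv_continuous : continuous homeo_inv }.

Section HomeoGroup.
Variable X : topologicalType.
Implicit Types f g h : homeo X.

Lemma homeo_eq f g : f =1 g -> f = g.
Proof.
move=> /funext fg.
have ifg : homeo_inv f = homeo_inv g.
  apply: funext => x; apply: (can_inj (homeo_funK f)).
  by rewrite homeo_invK fg homeo_invK.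
case: f g fg ifg => f f' a b c d [g g' a' b' c' d'] /= fg fg'.
by subst g g'; congr Homeo; exact: Prop_irrelevance.
Qed.

Definition homeo_one : homeo X :=
  @Homeo X id id (frefl _) (frefl _) (fun=> cvg_id) (fun=> cvg_id).

Definition homeo_mul f g : homeo X :=
  @Homeo X (f \o g) (homeo_inv g \o homeo_inv f)
    (can_comp (homeo_funK f) (homeo_funK g))
    (can_comp (homeo_invK g) (homeo_invK f))
    (fun x => continuous_comp (@homeo_continuous X g x)
                              (@homeo_continuous X f (g x)))
    (fun x => continuous_comp (@homeo_inv_continuous X f x)
                              (@homeo_inv_continuous X g (homeo_inv f x))).

Definition homeo_sym f : homeo X :=
  Homeo (homeo_invK f) (homeo_funK f)
    (@homeo_inv_continuous X f) (@homeo_continuous X f).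

Lemma homeo_mulA : associative homeo_mul.
Proof. by move=> f g h; exact: homeo_eq. Qed.

Lemma homeo_1mul : left_id homeo_one homeo_mul.
Proof. by move=> f; exact: homeo_eq. Qed.

Lemma homeo_mul1 : right_id homeo_one homeo_mul.
Proof. by move=> f; exact: homeo_eq. Qed.

Lemma homeo_Vmul : left_inverse homeo_one homeo_sym homeo_mul.
Proof. by move=> f; apply: homeo_eq => x /=; exact: homeo_funK. Qed.

Lemma homeo_mulV : right_inverse homeo_one homeo_sym homeo_mul.
Proof. by move=> f; apply: homeo_eq => x /=; exact: homeo_invK. Qed.

HB.instance Definition _ := gen_eqMixin (homeo X).
HB.instance Definition _ := gen_choiceMixin (homeo X).
HB.instance Definition _ := isGroup.Build (homeo X)
  homeo_mulA homeo_1mul homeo_mul1 homeo_Vmul homeo_mulV.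

End HomeoGroup.

(* A homeomorphism group of X is a subgroup G of [homeo X], given as a
   [groupClosed (homeo X)] (classically, every subset is a boolean predicate);
   [homeo_group G] is G as a group in its own right. *)
Definition homeo_group (X : topologicalType) (G : groupClosed (homeo X)) :=
  {g : homeo X | g \in G}.

Section HomeoGroupType.
Variables (X : topologicalType) (G : groupClosed (homeo X)).

Lemma homeo_group_closed : group_closed G.
Proof. by split; [exact: gpred1 | exact: gpredF]. Qed.

HB.instance Definition _ := SubChoice.on (homeo_group G).
HB.instance Definition _ :=
  SubChoice_isSubGroup.Build _ _ (homeo_group G) homeo_group_closed.

End HomeoGroupType.

Definition prod_group (A : Type) (G : A -> groupType) := forall a, G a.

Section ProdGroup.
Variables (A : Type) (G : A -> groupType).

Let mul (g h : prod_group G) : prod_group G := fun a => g a * h a.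
Let one : prod_group G := fun=> 1.
Let inv (g : prod_group G) : prod_group G := fun a => (g a)^-1.

Let mulA : associative mul.
Proof. by move=> f g h; apply: functional_extensionality_dep => a; exact: mulgA. Qed.

Let mul1 : left_id one mul.
Proof. by move=> f; apply: functional_extensionality_dep => a; exact: mul1g. Qed.

Let onemul : right_id one mul.
Proof. by move=> f; apply: functional_extensionality_dep => a; exact: mulg1. Qed.

Let mulV : left_inverse one inv mul.
Proof. by move=> f; apply: functional_extensionality_dep => a; exact: mulVg. Qed.

Let Vmul : right_inverse one inv mul.
Proof. by move=> f; apply: functional_extensionality_dep => a; exact: mulgV. Qed.

HB.instance Definition _ := Choice.on (prod_group G).
HB.instance Definition _ := isGroup.Build (prod_group G)
  mulA mul1 onemul mulV Vmul.

End ProdGroup.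

Record action (G : groupType) (X : topologicalType) := Action {
  act :> G -> X -> X;
  act1 : forall x, act 1 x = x;
  actM : forall g h x, act (g * h) x = act g (act h x);
  act_continuous : forall g, continuous (act g) }.

Section HomeoAction.
Variables (X : topologicalType) (G : groupClosed (homeo X)).

Definition homeo_action : action (homeo_group G) X :=
  @Action (homeo_group G) X (fun g x => \val g x)
    (fun=> erefl) (fun _ _ _ => erefl) (fun g => @homeo_continuous X (\val g)).

End HomeoAction.

Section ProdAction.
Variables (A : Type) (G : A -> groupType) (X : A -> topologicalType).
Variable op : forall a, action (G a) (X a).

Definition prod_act (g : prod_group G) (x : prod_topology X) : prod_topology X :=
  fun a => op a (g a) (x a).

Lemma prod_act1 x : prod_act 1 x = x.
Proof. by apply: functional_extensionality_dep => a; exact: act1. Qed.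

Lemma prod_actM g h x : prod_act (g * h) x = prod_act g (prod_act h x).
Proof. by apply: functional_extensionality_dep => a; exact: actM. Qed.

Lemma prod_act_continuous g : continuous (prod_act g).
Proof.
move=> x.
have Fx : Filter (nbhs (x : prod_topology X)) by exact: nbhs_filter.
apply/(@cvg_sup _ _ _ _ _ (fmap_filter _ Fx)) => a.
apply: (@continuous_comp_initial _ (prod_topology X) _
  (fun f : prod_topology X => f a)) => y.
have proj_cvg : f a @[f --> (y : prod_topology X)] --> y a.
  have Fy : Filter (nbhs (y : prod_topology X)) by exact: nbhs_filter.
  have /(@cvg_sup _ _ _ _ _ Fy)/(_ a) ya : nbhs (y : prod_topology X) --> y.
    exact: cvg_id.
  by apply: cvg_trans (cvg_app _ ya) _; exact: initial_continuous.
exact: (cvg_comp _ _ proj_cvg (@act_continuous _ _ (op a) (g a) (y a))).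
Qed.

Definition prod_action : action (prod_group G) (prod_topology X) :=
  Action prod_act1 prod_actM prod_act_continuous.

End ProdAction.

Section Orbits.
Variables (G : groupType) (X : topologicalType) (op : action G X).

Definition act_orbit (x : X) : set X := [set op g x | g in [set: G]].

Definition closed_orbits : set (set X) :=
  [set O | closed O /\ exists x, O = act_orbit x].

Definition dense_closed_orbits : Prop :=
  dense (\bigcup_(O in closed_orbits) O).

End Orbits.

(* Main.v *)
(* By choice, an orbit of the product group is the product of the orbits of the
   coordinates; it is closed iff each factor is.  Density of a product of dense
   sets needs no finiteness argument, because it holds already in the finer box
   topology. *)
Require Import Defs.
From mathcomp Require Import all_boot all_classical topology function_spaces.
Local Open Scope classical_set_scope.

Lemma choice_dep (A : Type) (T : A -> Type) (P : forall a, T a -> Prop) :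
  (forall a, exists x, P a x) -> exists f : forall a, T a, forall a, P a (f a).
Proof.
move=> exP; pose Pf a := cid (exP a).
by exists (fun a => projT1 (Pf a)) => a; case: (Pf a).
Qed.

(* [{classic A}] is [A] with its classical [eqType] structure, which [proj] and
   [dfwith] require of the index type. *)
Lemma prod_eval_continuous (A : Type) (X : A -> topologicalType) (a : A) :
  continuous (fun x : prod_topology X => x a).
Proof. exact: (@proj_continuous {classic A} X a). Qed.

(** The sets containing a box around [x] form a filter. This filter converges to [x] in each
    coordinate, hence in the product topology, so it contains every neighbourhood of [x]. *)
Lemma box_nbhs (A : Type) (X : A -> topologicalType) (x : prod_topology X)
    (B : set (prod_topology X)) :
  nbhs x B -> exists2 V : forall a, set (X a),
    forall a, nbhs (x a) (V a) & [set y | forall a, V a (y a)] `<=` B.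
Proof.
pose box : set_system (prod_topology X) :=
  [set B | exists2 V : forall a, set (X a),
    forall a, nbhs (x a) (V a) & [set y | forall a, V a (y a)] `<=` B].
have box_filter : Filter box.
  split=> [|C D [V xV VC] [W xW WD]|C D CD [V xV VC]].
  - by exists (fun=> setT) => // a; exact: filterT.
  - exists (fun a => V a `&` W a) => [a|y VWy]; first exact: filterI.
    by split; [apply: VC => a; case: (VWy a)|apply: WD => a; case: (VWy a)].
  - by exists V => //; exact: subset_trans CD.
suff box_cvg : box --> x by exact: box_cvg.
apply/(@cvg_sup _ _ _ _ _ box_filter) => a C.
rewrite nbhsE /= => -[D [[U oU UD] Dx] DC].
(* The box that is [U] at [a] and the whole space at every other index. *)
exists (dfwith (T := fun b : {classic A} => set (X b)) (fun=> setT) a U).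
  move=> b; case: (@dfwithP {classic A}) => [|i _]; last exact: filterT.
  by apply: open_nbhs_nbhs; split=> //; rewrite -UD in Dx.
move=> y Vy; apply: DC; rewrite -UD /=.
by have := Vy a; rewrite (@dfwithin {classic A}).
Qed.

Lemma dense_prod (A : Type) (X : A -> topologicalType)
    (D : forall a, set (X a)) :
  (forall a, dense (D a)) ->
  dense [set x : prod_topology X | forall a, D a (x a)].
Proof.
move=> dD O [x Ox] oO.
have [V xV VO] : exists2 V : forall a, set (X a),
    forall a, nbhs (x a) (V a) & [set y | forall a, V a (y a)] `<=` O.
  exact/box_nbhs/open_nbhs_nbhs.
have /choice_dep[y yP] a : exists y, V a y /\ D a y.
  have [|y [/interior_subset Vy Dy]] := dD a (V a)° _ (open_interior _).
    by exists (x a); exact: xV.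
  by exists y.
by exists y; split=> [|a]; [apply: VO => a|]; case: (yP a).
Qed.

Lemma act_orbit_refl (G : groupType) (X : topologicalType) (op : action G X)
    (x : X) : act_orbit op x x.
Proof. by exists 1%g => //; exact: act1. Qed.

Section ProdOrbits.
Variables (A : Type) (G : A -> groupType) (X : A -> topologicalType).
Variable op : forall a, action (G a) (X a).

Lemma prod_orbitE (x : prod_topology X) :
  act_orbit (prod_action op) x =
  [set y | forall a, act_orbit (op a) (x a) (y a)].
Proof.
apply/seteqP; split=> [_ [g _ <-] a|y xy]; first by exists (g a).
have /choice_dep[g gP] a : exists g, op a g (x a) = y a.
  by have [g _] := xy a; exists g.
by exists g => //; exact: functional_extensionality_dep.
Qed.

(** Varying only coordinate [a] of [x] embeds [X a] continuously as a slice through [x], and the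
    preimage of the product orbit is the orbit of [x a]. Conversely, the product orbit is an
    intersection of preimages of closed sets under projections. *)
Lemma closed_prod_orbitP (x : prod_topology X) :
  closed (act_orbit (prod_action op) x) <->
  forall a, closed (act_orbit (op a) (x a)).
Proof.
rewrite prod_orbitE; split=> [cx a|cx].
  pose f : X a -> prod_topology X :=
    dfwith (T := fun b : {classic A} => X b) x a.
  have -> : act_orbit (op a) (x a) =
      f @^-1` [set y | forall a, act_orbit (op a) (x a) (y a)].
    apply/seteqP; split=> y /=.
      (* Away from [a] the slice keeps [x i], which lies in its own orbit. *)
      move=> xy b; rewrite /f; case: (@dfwithP {classic A}) => // i _.
      exact: act_orbit_refl.
    by move/(_ a); rewrite /f (@dfwithin {classic A}).
  apply: preimage_closed => // y _.
  exact: (@dfwith_continuous {classic A} X).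
have -> : [set y : prod_topology X | forall a, act_orbit (op a) (x a) (y a)] =
    \bigcap_a ((fun y : prod_topology X => y a) @^-1` act_orbit (op a) (x a)).
  by apply/seteqP; split=> y xy a; [move=> _|]; exact: xy.
apply: closed_bigI => a _; apply: preimage_closed => // y _.
exact: prod_eval_continuous.
Qed.

End ProdOrbits.

(** All points of an orbit have that same orbit. The union thus becomes a condition on single
    points, which for a product splits over the coordinates. *)
Lemma closed_orbitsUE (G : groupType) (X : topologicalType) (op : action G X) :
  \bigcup_(O in closed_orbits op) O = [set x | closed (act_orbit op x)].
Proof.
apply/seteqP; split=> x; last first.
  by move=> cx; exists (act_orbit op x); [split=> //; exists x|exact: act_orbit_refl].
move=> [_ [/[swap] -[y ->] cO] [g _ <-]] /=.
suff -> : act_orbit op (op g y) = act_orbit op y by [].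
apply/seteqP; split=> _ [h _ <-]; first by exists (h * g)%g; rewrite ?actM.
by exists (h * g^-1)%g; rewrite // -actM mulgVK.
Qed.

(** Nonempty factors matter from left to right: with an empty factor the product is empty and
    density there is vacuous. *)
Lemma dense_prod_closed_orbits (A : Type) (G : A -> groupType)
    (X : A -> topologicalType) (op : forall a, action (G a) (X a)) :
  (forall a, [set: X a] !=set0) ->
  dense_closed_orbits (prod_action op) <->
  forall a, dense_closed_orbits (op a).
Proof.
move=> /choice_dep[x0 _]; rewrite /dense_closed_orbits closed_orbitsUE.
have -> : [set x | closed (act_orbit (prod_action op) x)] =
    [set x | forall a, closed (act_orbit (op a) (x a))].
  by apply/seteqP; split=> x /= /closed_prod_orbitP.
split=> [dX a U [u Uu] oU|dX]; last first.
  apply: (@dense_prod A X (fun a => [set x | closed (act_orbit (op a) x)])) => a.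
  by rewrite -closed_orbitsUE.
rewrite closed_orbitsUE.
(* The cylinder over [U] is open, and the base point [x0] with coordinate [a] replaced by [u] shows
   that it is nonempty. *)
have [||x [Ux cx]] := dX ((fun x : prod_topology X => x a) @^-1` U).
- exists (dfwith (T := fun b : {classic A} => X b) x0 a u) => /=.
  by rewrite (@dfwithin {classic A}).
- by apply: open_comp => // x _; exact: prod_eval_continuous.
- by exists (x a); split=> [|/=]; [exact: Ux|exact: cx].
Qed.

Theorem theorem4p1 (A : Type) (X : A -> topologicalType)
    (X_infinite : forall a : A, infinite_set [set: X a])
    (G : forall a : A, groupClosed (homeo (X a))) :
  dense_closed_orbits (prod_action (fun a : A => homeo_action (G a))) <->
  forall a : A, dense_closed_orbits (homeo_action (G a)).
Proof.
by apply: dense_prod_closed_orbits => a; exact: infinite_setN0.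
Qed.
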